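(* Let $G$ be a graph with vertex set $[N]$ and let $\hat G$ be the cone over $G$. If $(G,d)$ has the positive margins property, then $(\hat G,\hat d)$ also has the positive margins property, where $\hat d_v=d_v$ for $v\in[N]$ and $\hat d_0$ is arbitrary.
   Context: Graphs are finite, simple, undirected; all $d_v$ (and $\hat d_v$) are integers $\ge2$. For $G=(V,E)$ with $V=[N]=\{1,\dots,N\}$, the cone over $G$ is the graph $\hat G=(\hat V,\hat E)$ with $\hat V=V\cup\{0\}$ and $\hat E=E\cup\{(0,i):i\in[N]\}$. For a graph $G=(V,E)$ and $d=(d_v)_{v\in V}$, let $\mathcal X=\prod_{v\in V}[d_v]$, $x_W=(x_v)_{v\in W}$. $\mathcal B_{\mathrm{gl}(G)}\subset\mathbb Z^{\mathcal X}$ is the set of all moves $e_{x_Ax_Bx_C}+e_{x'_Ax'_Bx_C}-e_{x_Ax'_Bx_C}-e_{x'_Ax_Bx_C}$ ($e_x$ = unit vectors), where $A,B,C$ range over all partitions $V=A\cup B\cup C$ into disjoint (possibly empty) sets such that every path in $G$ from a vertex of $A$ to a vertex of $B$ meets $C$, and $x_A,x'_A,x_B,x'_B,x_C$ range over all states of the respective subsets. $A_G$ is the integer matrix with $(A_Gu)_{W,y}=\sum_{x\in\mathcal X:\,x_W=y}u_x$ for every clique $W$ of $G$ and $y\in\prod_{v\in W}[d_v]$. The fiber of $u\in\mathbb N^{\mathcal X}$ is $\{v\in\mathbb N^{\mathcal X}:A_Gv=A_Gu\}$ ($0\in\mathbb N$). It is connected by $\mathcal B_{\mathrm{gl}(G)}$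 if any two of its elements are joined by a finite sequence in $\mathbb N^{\mathcal X}$ whose consecutive differences lie in $\pm\mathcal B_{\mathrm{gl}(G)}$. $(G,d)$ has the positive margins property if, for every $u\in\mathbb N^{\mathcal X}$ such that all entries of $A_Gu$ are strictly positive, the fiber of $u$ is connected by $\mathcal B_{\mathrm{gl}(G)}$. *)

(* Defs.v *)
From Stdlib Require Export Relation_Operators.
From mathcomp Require Export all_boot all_order all_algebra.

Set Implicit Arguments.
Unset Strict Implicit.
Unset Printing Implicit Defensive.

Import GRing.Theory.

Record sgraph (V : finType) := SGraph {
  edge :> rel V;
  edge_sym : symmetric edge;
  edge_irr : irreflexive edge
}.

(* The cone over G has vertex set [option V]; [None] is the apex 0. *)
Section Cone.
Variables (V : finType) (G : sgraph V).

Definition cone_rel : rel (option V) := fun u v =>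
  match u, v with
  | Some i, Some j => G i j
  | None, None => false
  | _, _ => true
  end.

Lemma cone_sym : symmetric cone_rel.
Proof. by case=> [i|] [j|] //=; apply: edge_sym. Qed.

Lemma cone_irr : irreflexive cone_rel.
Proof. by case=> [i|] //=; apply: edge_irr. Qed.

Definition cone : sgraph (option V) := SGraph cone_sym cone_irr.

Definition cone_dim (d0 : nat) (d : V -> nat) : option V -> nat :=
  fun v => if v is Some i then d i else d0.

End Cone.

Section PositiveMargins.
Variables (V : finType) (G : sgraph V) (d : V -> nat).

Definition clique (W : {set V}) : bool :=
  [forall u in W, forall v in W, (u != v) ==> G u v].

Definition separates (A B C : {set V}) : Prop :=
  forall (a : V) (p : seq V), a \in A -> path G a p -> uniq (a :: p) ->
    last a p \in B -> has (mem C) (a :: p).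

Definition separation (A B C : {set V}) : Prop :=
  [/\ A :|: B :|: C = [set: V],
      [/\ [disjoint A & B], [disjoint A & C] & [disjoint B & C]]
    & separates A B C].

Definition state : finType := {dffun forall v : V, 'I_(d v)}.

Definition substate (W : {set V}) : finType :=
  {dffun forall v : {v : V | v \in W}, 'I_(d (val v))}.

Definition restrict (W : {set V}) (x : state) : substate W :=
  [ffun v : {v : V | v \in W} => x (val v)].

Definition nvec := {ffun state -> nat}.
Definition zvec := {ffun state -> int}.

Definition nvec_to_zvec (u : nvec) : zvec := [ffun x => (u x)%:Z%R].

Definition unit_vec (x : state) : zvec := [ffun y => (y == x)%:Z%R].

(* [override S x x'] takes the coordinates in S from x', the others from x. *)
Definition override (S : {set V}) (x x' : state) : state :=
  [ffun v => if v \in S then x' v else x v].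

(* With x = (x_A, x_B, x_C) and x' = (x'_A, x'_B, _), the four states are
   (x_A, x_B, x_C), (x'_A, x'_B, x_C), (x_A, x'_B, x_C), (x'_A, x_B, x_C);
   the C-part of x' is never used. *)
Definition global_markov_move (m : zvec) : Prop :=
  exists (A B C : {set V}) (x x' : state), separation A B C /\
    m = (unit_vec x + unit_vec (override (A :|: B) x x')
         - unit_vec (override B x x') - unit_vec (override A x x'))%R.

(* The entry (A_G u)_(W, y). *)
Definition margin (u : nvec) (W : {set V}) (y : substate W) : nat :=
  \sum_(x : state | restrict W x == y) u x.

Definition same_fiber (u v : nvec) : Prop :=
  forall (W : {set V}) (y : substate W), clique W -> margin v y = margin u y.

Definition step (v w : nvec) : Prop :=
  let m := (nvec_to_zvec w - nvec_to_zvec v)%R in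
  global_markov_move m \/ global_markov_move (- m)%R.

Definition fiber_connected (u : nvec) : Prop :=
  forall v w : nvec, same_fiber u v -> same_fiber u w ->
    clos_refl_trans nvec step v w.

Definition positive_margins : Prop :=
  forall u : nvec,
    (forall (W : {set V}) (y : substate W), clique W -> 0 < margin u y) ->
    fiber_connected u.

End PositiveMargins.

(* Main.v *)
(* A vector on the states of the cone splits into one slice per apex value k.
   The margin of the k-slice at a clique W of G is the margin of the whole
   vector at the clique W + apex, so positivity and fibers are inherited by
   slices.  Adding the apex to C turns a separation of G into one of the cone,
   so a path of moves in a slice lifts to a path fixing the other slices, and
   the slices can be changed one after the other. *)
Require Import Defs.

Import GRing.Theory.
Local Open Scope ring_scope.

Set Implicit Arguments.
Unset Strict Implicit.
Unset Printing Implicit Defensive.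

Lemma restrict_eqP (V : finType) (d : V -> nat) (W : {set V}) (x y : state d) :
  reflect {in W, forall v, x v = y v} (restrict W x == restrict W y).
Proof.
apply: (iffP eqP) => [/ffunP eq_xy v vW | eq_xy].
  by have := eq_xy (exist _ v vW); rewrite !ffunE.
by apply/ffunP => -[v vW]; rewrite !ffunE /= eq_xy.
Qed.

(** Positive dimensions provide a default value outside [W]. Every margin index thus becomes a
    [restrict W x], the form that [margin_slice] needs to compare indices over [G] and over its
    cone. *)
Lemma restrict_surj (V : finType) (d : V -> nat) (W : {set V}) (y : substate d W) :
  (forall v, 0 < d v)%N -> exists x : state d, restrict W x = y.
Proof.
move=> d_gt0; exists [ffun v => if @idP (v \in W) is ReflectT vW
  then y (exist _ v vW) else Ordinal (d_gt0 v)].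
apply/ffunP => -[v vW]; rewrite !ffunE /=.
by case: {-}_ / idP => [vW' | //]; rewrite (bool_irrelevance vW' vW).
Qed.

Section ConeSlices.
Variables (V : finType) (G : sgraph V) (d : V -> nat) (d0 : nat).

Local Notation dhat := (cone_dim d0 d).
Implicit Types (k : 'I_d0) (x : state d) (z : state dhat) (W S : {set V}).
Implicit Types (u v w : nvec dhat) (f g : nvec d).

Definition apex_val z : 'I_d0 := z None.

Definition base_state z : state d := [ffun i => z (Some i)].

Definition cone_state k x : state dhat :=
  [ffun i => if i is Some j return 'I_(dhat i) then x j else k].

Definition cone_set W : {set option V} := None |: Some @: W.

Lemma apex_cone k x : apex_val (cone_state k x) = k.
Proof. by rewrite /apex_val ffunE. Qed.

Lemma base_cone k x : base_state (cone_state k x) = x.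
Proof. by apply/ffunP => i; rewrite !ffunE. Qed.

Lemma cone_stateK z : cone_state (apex_val z) (base_state z) = z.
Proof. by apply/ffunP => -[i|]; rewrite !ffunE. Qed.

Lemma eq_cone_state z k x :
  (z == cone_state k x) = (apex_val z == k) && (base_state z == x).
Proof.
apply/eqP/andP => [-> | [/eqP <- /eqP <-]]; last by rewrite cone_stateK.
by rewrite apex_cone base_cone.
Qed.

Lemma mem_Some S i : (Some i \in Some @: S) = (i \in S).
Proof. by rewrite mem_imset //; apply: Some_inj. Qed.

Lemma None_notin_Some S : (None \in Some @: S) = false.
Proof. by apply/imsetP => -[]. Qed.

Lemma override_cone S k x x' :
  override (Some @: S) (cone_state k x) (cone_state k x') =
  cone_state k (override S x x').
Proof.
apply/ffunP => -[i|]; rewrite !ffunE ?mem_Some //.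
by rewrite None_notin_Some.
Qed.

Lemma clique_cone W : clique G W -> clique (cone G) (cone_set W).
Proof.
move=> /'forall_implyP clW; apply/'forall_implyP => -[i|] iW;
  apply/'forall_implyP => -[j|] jW; apply/implyP => // ij.
move: iW jW; rewrite !inE /= !mem_Some => iW jW.
by have /'forall_implyP/(_ _ jW)/implyP := clW _ iW; apply.
Qed.

(** A path through the apex meets [cone_set C] there; a path avoiding it already lies in [G]. *)
Lemma separation_cone A B C : separation G A B C ->
  separation (cone G) (Some @: A) (Some @: B) (cone_set C).
Proof.
case=> ABC [dAB dAC dBC] sep.
have dS (S T : {set V}) : [disjoint S & T] -> [disjoint Some @: S & Some @: T].
  by rewrite (imset_disjoint Some_inj).
have dN (S T : {set V}) : [disjoint S & T] -> [disjoint Some @: S & cone_set T].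
  move=> /dS dST; rewrite disjoint_sym disjoints_subset subUset sub1set.
  by rewrite inE None_notin_Some -disjoints_subset disjoint_sym.
split; first 1 last.
- by split; [apply: dS | apply: dN | apply: dN].
- move=> _ p /imsetP[a aA ->] pth unq lst.
  (* The path starts at [Some a], so the apex can only occur in its tail [p]. *)
  have [Np | Np] := boolP (None \in p).
    by apply/hasP; exists None; rewrite !inE ?Np ?orbT.
  have [q def_p] : exists q, p = map Some q.
    elim: p Np {pth unq lst} => [|[i|] p IHp]; first by exists [::].
      by rewrite inE => /IHp[q ->]; exists (i :: q).
    by rewrite inE.
  rewrite def_p in pth unq lst *; rewrite last_map mem_Some in lst.
  (* Between [Some] vertices the cone relation computes to [G], so [pth] becomes a path of [G]. *)
  rewrite path_map in pth; rewrite -map_cons (map_inj_uniq Some_inj) in unq.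
  have /hasP[c cp cC] := sep a q aA pth unq lst.
  apply/hasP; exists (Some c); first by rewrite -map_cons map_f.
  by rewrite /= !inE mem_Some.
apply/setP => -[i|]; rewrite !inE ?orbT //= !mem_Some.
by have /setP/(_ i) := ABC; rewrite !inE.
Qed.

Definition slice k u : nvec d := [ffun x => u (cone_state k x)].

Definition set_slice k u f : nvec dhat :=
  [ffun z => if apex_val z == k then f (base_state z) else u z].

(** Since [cone_set W] contains the apex, the states summed on the right are exactly the
    [cone_state k t] with [t] agreeing with [x] on [W]. *)
Lemma margin_slice k u W x :
  margin (slice k u) (restrict W x) =
  margin u (restrict (cone_set W) (cone_state k x)).
Proof.
rewrite /margin [RHS](reindex_onto (cone_state k) base_state) /=; last first.
  move=> z /restrict_eqP/(_ None); rewrite !inE => /(_ isT) zk.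
  by apply/esym/eqP; rewrite eq_cone_state eqxx andbT /apex_val zk !ffunE.
apply: eq_big => [t | t _]; last by rewrite ffunE.
rewrite base_cone eqxx andbT.
apply/restrict_eqP/restrict_eqP => eq_tx.
  by move=> [i|] iW; rewrite !ffunE // eq_tx // -mem_Some; move: iW; rewrite !inE.
by move=> i iW; have := eq_tx (Some i); rewrite !ffunE !inE mem_Some; apply.
Qed.

Definition lift_zvec k (m : zvec d) : zvec dhat :=
  [ffun z => if apex_val z == k then m (base_state z) else 0].

Lemma lift_zvecD k : {morph lift_zvec k : m n / m + n}.
Proof. by move=> m n; apply/ffunP => z; rewrite !ffunE; case: eqP; rewrite ?addr0. Qed.

Lemma lift_zvecN k : {morph lift_zvec k : m / - m}.
Proof. by move=> m; apply/ffunP => z; rewrite !ffunE; case: eqP; rewrite ?oppr0. Qed.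

Lemma lift_unit_vec k x : lift_zvec k (unit_vec x) = unit_vec (cone_state k x).
Proof. by apply/ffunP => z; rewrite !ffunE eq_cone_state; case: eqP. Qed.

(** The apex joins the [C] part, so all four states of the lifted move share the apex value [k]. *)
Lemma global_markov_move_lift k m :
  global_markov_move G m -> global_markov_move (cone G) (lift_zvec k m).
Proof.
case=> A [B [C [x [x' [sep ->]]]]].
exists (Some @: A), (Some @: B), (cone_set C), (cone_state k x), (cone_state k x').
split; first exact: separation_cone.
by rewrite -imsetU !override_cone !(lift_zvecD, lift_zvecN) !lift_unit_vec.
Qed.

(** Outside slice [k] both vectors equal [u], so their difference is the lift of the difference of
    [f] and [g]. *)
Lemma step_set_slice k u f g :
  step G f g -> step (cone G) (set_slice k u f) (set_slice k u g).
Proof.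
have lift : nvec_to_zvec (set_slice k u g) - nvec_to_zvec (set_slice k u f) =
            lift_zvec k (nvec_to_zvec g - nvec_to_zvec f).
  by apply/ffunP => z; rewrite !ffunE; case: eqP; rewrite ?subrr.
rewrite /step lift -lift_zvecN.
by case=> /(global_markov_move_lift k); [left | right].
Qed.

Lemma connected_set_slice k u f g : clos_refl_trans _ (@step _ G d) f g ->
  clos_refl_trans _ (@step _ (cone G) dhat) (set_slice k u f) (set_slice k u g).
Proof.
elim=> [f1 f2 /(step_set_slice k u) | f1 | f1 f2 f3 _ c12 _ c23].
- exact: rt_step.
- exact: rt_refl.
- exact: rt_trans c12 c23.
Qed.

Lemma connected_slices v w :
  (forall k, clos_refl_trans _ (@step _ G d) (slice k v) (slice k w)) ->
  clos_refl_trans _ (@step _ (cone G) dhat) v w.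
Proof.
move=> conn.
(* A hybrid of [v] and [w]: the slices listed in [s] have already been changed. Induction on [s]
   goes from [v] to [w]. *)
pose mix (s : seq 'I_d0) : nvec dhat := [ffun z => if apex_val z \in s then w z else v z].
have -> : w = mix (enum 'I_d0) by apply/ffunP => z; rewrite ffunE mem_enum.
elim: (enum _) => [|k s IHs].
  have -> : mix [::] = v by apply/ffunP => z; rewrite ffunE.
  exact: rt_refl.
apply: rt_trans IHs _.
have -> : mix (k :: s) = set_slice k (mix s) (slice k w).
  by apply/ffunP => z; rewrite !ffunE inE; case: eqP => //= <-; rewrite cone_stateK.
have {1}-> : mix s = set_slice k (mix s) (slice k (mix s)).
  by apply/ffunP => z; rewrite !ffunE; case: eqP => //= <-; rewrite cone_stateK.
apply: connected_set_slice.
(* The induction runs over arbitrary lists, so [k] may already be in [s]; the path is then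
   trivial. *)
have -> : slice k (mix s) = if k \in s then slice k w else slice k v.
  by apply/ffunP => x; rewrite !ffunE apex_cone; case: ifP; rewrite !ffunE.
by case: ifP => _; [apply: rt_refl | apply: conn].
Qed.

Lemma positive_margins_cone : (forall i, 0 < d i)%N ->
  positive_margins G d -> positive_margins (cone G) dhat.
Proof.
move=> d_gt0 pmG u u_gt0 v w uv uw; apply: connected_slices => k.
(* Equal margins on the cliques [cone_set W] of the cone give equal slice margins on the cliques [W]
   of [G]. *)
have fib t : same_fiber (cone G) u t -> same_fiber G (slice k u) (slice k t).
  move=> ut W y /clique_cone clW; have [x <-] := restrict_surj y d_gt0.
  by rewrite !margin_slice ut.
apply: (pmG (slice k u)); [move=> W y /clique_cone clW | exact: fib | exact: fib].
by have [x <-] := restrict_surj y d_gt0; rewrite margin_slice u_gt0.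
Qed.

End ConeSlices.

Local Close Scope ring_scope.

Theorem lemma4p8 (N : nat) (G : sgraph 'I_N) (d : 'I_N -> nat) (d0 : nat)
    (hd : forall v, 2 <= d v) (hd0 : 2 <= d0) :
  positive_margins G d -> positive_margins (cone G) (cone_dim d0 d).
Proof. by apply: positive_margins_cone => i; apply: ltnW. Qed.
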